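(* Let $G$ be a connected bipartite graph on $n\ge 4$ vertices, and let $\lambda_2$ be the second largest eigenvalue of its normalized adjacency matrix $D^{-1}A$. Then $$\sqrt{\frac{2(R_{-1}(G)-1)}{(n-2)(n-3)}}\le\lambda_2\le\sqrt{\frac{2(n-3)(R_{-1}(G)-1)}{n-2}}.$$
   Context: Graphs are simple, finite and undirected. $A$ is the adjacency matrix, $D$ the diagonal matrix of vertex degrees $d_i$, and $D^{-1}A$ the normalized adjacency matrix, with real eigenvalues $\lambda_1\ge\lambda_2\ge\cdots\ge\lambda_n$. $R_{-1}(G)=\sum_{\{i,j\}\in E}\frac{1}{d_id_j}$, the sum over the edges of $G$. *)

(* Defs.v *)
From HB Require Import structures.
From mathcomp Require Import all_boot all_order all_algebra.
From mathcomp Require Import polyrcf.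

Set Implicit Arguments.
Unset Strict Implicit.
Unset Printing Implicit Defensive.

Import Order.TTheory GRing.Theory Num.Theory.
Local Open Scope ring_scope.

(* Graphs on the vertex set 'I_n are given by their adjacency relation. *)

Definition simple_graph n (e : rel 'I_n) : Prop :=
  symmetric e /\ irreflexive e.

(* This holds vacuously when n = 0. *)
Definition connected_graph n (e : rel 'I_n) : Prop :=
  forall x y, connect e x y.

(* X and its complement are the two colour classes. *)
Definition bipartite_graph n (e : rel 'I_n) : Prop :=
  exists X : {set 'I_n}, forall x y, e x y -> (x \in X) != (y \in X).

Definition degree n (e : rel 'I_n) (i : 'I_n) : nat := #|[set j | e i j]|.

Definition adj_mx (R : rcfType) n (e : rel 'I_n) : 'M[R]_n :=
  \matrix_(i, j) (e i j)%:R.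

Definition degree_mx (R : rcfType) n (e : rel 'I_n) : 'M[R]_n :=
  diag_mx (\row_i (degree e i)%:R).

(* invmx is the inverse only on invertible matrices, so this is D^-1 A only
   when no vertex is isolated. *)
Definition normalized_adj_mx (R : rcfType) n (e : rel 'I_n) : 'M[R]_n :=
  invmx (degree_mx R e) *m adj_mx R e.

(* The eigenvalues of M lying in R, each repeated according to its algebraic
   multiplicity, in nonincreasing order. When char_poly M splits over R, as it
   does for the normalized adjacency matrix, the list has size n. *)
Definition eigenvalues (R : rcfType) n (M : 'M[R]_n) : seq R :=
  sort >=%R (flatten [seq nseq (mup x (char_poly M)) x
                     | x <- rootsR (char_poly M)]).

(* lambda_2: list positions start at 0. *)
Definition second_eigenvalue (R : rcfType) n (M : 'M[R]_n) : R :=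
  (eigenvalues M)`_1.

(* Each edge {i, j} is counted once, through its orientation with i < j. *)
Definition randic_m1 (R : rcfType) n (e : rel 'I_n) : R :=
  \sum_(i < n) \sum_(j < n | (i < j)%N && e i j)
    1 / ((degree e i)%:R * (degree e j)%:R).

(* Main.v *)
(* The matrix D^-1 A is similar to the symmetric matrix D^-1/2 A D^-1/2, so its
   spectrum is real, with sum tr (D^-1 A) = 0 and sum of squares
   tr ((D^-1 A)^2) = 2 R_-1. It lies in [-1, 1], and contains 1 and, the graph
   being bipartite, also -1. The other n - 2 eigenvalues x therefore have sum 0,
   sum of squares S = 2 (R_-1 - 1) and maximum l = lambda_2. With k = n - 3,
   the bound S <= (k + 1) k l^2 is sum (l - x) (x + k l) >= 0, and
   (k + 1) l^2 <= k S comes from sum (k x + l)^2 >= 0, where the last sum omits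
   one occurrence of l. *)

Require Import Defs.
From HB Require Import structures.
From mathcomp Require Import all_boot all_order all_algebra.
From mathcomp Require Import polyrcf complex ring lra.

Set Implicit Arguments.
Unset Strict Implicit.
Unset Printing Implicit Defensive.

Import Order.TTheory GRing.Theory Num.Theory.
Local Open Scope ring_scope.

(** * Spectra as lists: multiplicities, similarity, diagonalization *)

Lemma mem_rootsR (R : rcfType) (p : {poly R}) x :
  p != 0 -> (x \in rootsR p) = root p x.
Proof. by move=> p0; rewrite -(roots_on_rootsR p0) inE. Qed.

Lemma mup_prod_XsubC (F : fieldType) (s : seq F) x :
  mup x (\prod_(y <- s) ('X - y%:P)) = count_mem x s.
Proof.
elim: s => [|y s IHs]; first by rewrite big_nil mupNroot // root1.
have s0 : \prod_(z <- s) ('X - z%:P) != 0 by exact/monic_neq0/monic_prod_XsubC.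
rewrite big_cons mupM ?polyXsubC_eq0 // IHs /=.
by rewrite -['X - _]expr1 mup_XsubCX; case: eqP.
Qed.

(** In both lists [x] occurs as often as its multiplicity as a root of [char_poly M]. Sums over the
    spectrum can thus be computed on any splitting of the characteristic polynomial. *)
Lemma perm_eigenvalues (R : rcfType) n (M : 'M[R]_n) (s : seq R) :
  char_poly M = \prod_(x <- s) ('X - x%:P) -> perm_eq (eigenvalues M) s.
Proof.
move=> Ms; rewrite /eigenvalues perm_sort; apply/allP => x _ /=.
rewrite Ms; set p := \prod_(y <- s) _.
have p0 : p != 0 by exact/monic_neq0/monic_prod_XsubC.
have count_nseqs (r : seq R) : uniq r ->
    count_mem x (flatten [seq nseq (mup y p) y | y <- r])
    = ((x \in r) * mup x p)%N.
  elim: r => //= y r IHr /andP[yr /IHr]; rewrite count_cat count_nseq => -> /=.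
  rewrite inE eq_sym; have [->|_ //] := eqVneq x y.
  by rewrite (negbTE yr) mul0n addn0.
rewrite count_nseqs ?uniq_roots // mem_rootsR // mup_prod_XsubC root_prod_XsubC.
by have [_|/count_memPn ->] := boolP (x \in s); rewrite ?mul1n.
Qed.

Lemma char_poly_conj (F : fieldType) n (P B : 'M[F]_n) : P \in unitmx ->
  char_poly (invmx P *m B *m P) = char_poly B.
Proof.
move=> Pu; rewrite /char_poly /char_poly_mx.
have PK : map_mx polyC (invmx P) *m map_mx polyC P = 1%:M.
  by rewrite -map_mxM mulVmx // map_mx1.
have -> : 'X%:M - map_mx polyC (invmx P *m B *m P)
    = map_mx polyC (invmx P) *m ('X%:M - map_mx polyC B) *m map_mx polyC P.
  by rewrite mulmxBr mulmxBl !map_mxM mul_mx_scalar -scalemxAl PK scalemx1.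
by rewrite !det_mulmx mulrAC -det_mulmx PK det1 mul1r.
Qed.

(** The base change [P] may live in a larger field [K], but the diagonal comes from [F]: each
    identity is invariant under conjugation over [K] and descends because [f] is injective. *)
Lemma diagonalized_spectrum (F K : fieldType) (f : {rmorphism F -> K}) n
    (M : 'M[F]_n) (P : 'M[K]_n) (d : 'rV[F]_n) :
  P \in unitmx -> map_mx f M = invmx P *m diag_mx (map_mx f d) *m P ->
  [/\ char_poly M = \prod_i ('X - (d 0 i)%:P), \tr M = \sum_i d 0 i
    & \tr (M *m M) = \sum_i d 0 i ^+ 2].
Proof.
move=> Pu MP; have trP (B : 'M[K]_n) : \tr (invmx P *m B *m P) = \tr B.
  by rewrite mxtrace_mulC mulmxA mulmxV // mul1mx.
split.
- apply: (map_poly_inj f); rewrite map_char_poly MP char_poly_conj //.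
  rewrite char_poly_trig ?diag_mx_is_trig // rmorph_prod; apply: eq_bigr => i _.
  by rewrite rmorphB /= map_polyX map_polyC /= !mxE eqxx.
- apply: (fmorph_inj f); rewrite -trace_map_mx MP trP rmorph_sum mxtrace_diag.
  by apply: eq_bigr => i _; rewrite mxE.
- apply: (fmorph_inj f); rewrite -trace_map_mx map_mxM MP.
  set D := diag_mx _; have -> : invmx P *m D *m P *m (invmx P *m D *m P)
      = invmx P *m (D *m D) *m P by rewrite !mulmxA mulmxK.
  rewrite trP rmorph_sum mulmx_diag mxtrace_diag.
  by apply: eq_bigr => i _; rewrite !mxE rmorphXn expr2.
Qed.

(** Over [R[i]] the matrix is Hermitian, so the spectral theorem for normal matrices applies; its
    eigenvalues are real, hence equal to their real parts. *)
Lemma symmetric_diagonalization (R : rcfType) n (N : 'M[R]_n) : N^T = N ->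
  exists P : 'M[R[i]]_n, exists d : 'rV[R]_n, P \in unitmx /\
    map_mx (real_complex R) N
    = invmx P *m diag_mx (map_mx (real_complex R) d) *m P.
Proof.
move=> Nsym; set A := map_mx _ N.
have Aherm : A \is hermsymmx.
  apply: realsym_hermsym.
    by apply/is_hermitianmxP; rewrite expr0 scale1r map_mx_id // map_trmx Nsym.
  by apply/mxOverP => i j; rewrite mxE; apply/complex_realP; exists (N i j).
have /orthomx_spectralP Aeq := hermitian_normalmx Aherm.
have /mxOverP dreal := hermitian_spectral_diag_real Aherm.
exists (spectralmx A), (\row_i complex.Re (spectral_diag A 0 i)).
split; first exact: spectral_unit.
rewrite {1}Aeq; congr (_ *m diag_mx _ *m _).
by apply/rowP => i; rewrite !mxE RRe_real.
Qed.

(** * Inequalities for zero-sum lists, and the ends of a sorted list *)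

Lemma sum0_max_bounds (R : realFieldType) (l : R) (v : seq R) :
  let S := \sum_(x <- l :: v) x ^+ 2 in let k := (size v)%:R in
  \sum_(x <- l :: v) x = 0 -> {in v, forall x, x <= l} ->
  [/\ 0 <= l, S <= (k + 1) * k * l ^+ 2 & (k + 1) * l ^+ 2 <= k * S].
Proof.
move=> S k sum0 vl.
have sumv : \sum_(x <- v) x = - l.
  by move: sum0; rewrite big_cons addrC => /eqP; rewrite addr_eq0 => /eqP.
have size_sum (c : R) : \sum_(x <- v) c = k * c.
  by rewrite big_const_seq count_predT iter_addr_0 mulr_natl.
have SE : S = l ^+ 2 + \sum_(x <- v) x ^+ 2 by rewrite /S big_cons.
have gap_sum : \sum_(x <- v) (l - x) = (k + 1) * l.
  by rewrite sumrB size_sum sumv; ring.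
have gap_ge0 : 0 <= \sum_(x <- v) (l - x).
  by rewrite big_seq sumr_ge0 // => x /vl; rewrite subr_ge0.
have k0 : 0 <= k by rewrite ler0n.
have l0 : 0 <= l by rewrite gap_sum pmulr_rge0 // in gap_ge0; lra.
split=> //.
  (* The gap l - x is at most the sum of all gaps, which is (k + 1) l. *)
  have vk x : x \in v -> 0 <= x + k * l.
    move=> xv; suff : l - x <= (k + 1) * l by lra.
    rewrite -gap_sum (big_rem x) //= lerDl big_seq sumr_ge0 // => y /mem_rem.
    by move=> /vl; rewrite subr_ge0.
  have : 0 <= \sum_(x <- v) (l - x) * (x + k * l).
    rewrite big_seq sumr_ge0 // => x xv.
    by rewrite mulr_ge0 ?vk // subr_ge0 vl.
  have -> : \sum_(x <- v) (l - x) * (x + k * l)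
      = \sum_(x <- v) (k * l ^+ 2 + (1 - k) * l * x - x ^+ 2).
    by apply: eq_bigr => x _; ring.
  rewrite sumrB big_split /= size_sum -mulr_sumr sumv SE; lra.
have : 0 <= \sum_(x <- v) (k * x + l) ^+ 2.
  by rewrite sumr_ge0 // => x _; rewrite sqr_ge0.
have -> : \sum_(x <- v) (k * x + l) ^+ 2
    = \sum_(x <- v) (k ^+ 2 * x ^+ 2 + (2 * k * l) * x + l ^+ 2).
  by apply: eq_bigr => x _; ring.
rewrite !big_split /= size_sum -!mulr_sumr sumv SE; set T := \sum_(x <- v) _.
(* The sum of squares equals [k * (k * T - l ^+ 2)], and the goal amounts to [l ^+ 2 <= k * T].
   Dividing by [k] needs [k != 0]; if [k = 0], then [v] is empty and the zero sum forces [l = 0]. *)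
have [k_eq0 _|k_neq0 sq_ge0] := eqVneq k 0.
  have l_eq0 : l = 0.
    move: sumv; have -> : v = [::] by apply/nilP; rewrite /nilp -(eqr_nat R) -/k k_eq0.
    by rewrite big_nil => /eqP; rewrite eq_sym oppr_eq0 => /eqP.
  by rewrite l_eq0 k_eq0; lra.
have : 0 <= k * (k * T - l ^+ 2).
  by apply: le_trans sq_ge0 _; rewrite le_eqVlt; apply/predU1P; left; ring.
by rewrite pmulr_rge0 ?lt0r ?k_neq0 //; lra.
Qed.

(** Bounds that are attained must sit at the two ends of the sorted list; with at least three
    entries, position 1 is not the last one. *)
Lemma sorted_ends (R : realDomainType) (a b : R) (s : seq R) :
  (2 < size s)%N -> sorted >=%R s -> a \in s -> b \in s ->
  {in s, forall x, b <= x <= a} ->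
  exists l v, s = a :: l :: rcons v b /\ {in v, forall x, x <= l}.
Proof.
move=> + + a_s b_s bnd.
rewrite sorted_pairwise => [|y x z yx zy]; last exact: le_trans zy yx.
case: s a_s b_s bnd => [|a' [|l t]] //; case/lastP: t => // v b' a_s b_s bnd _.
rewrite !pairwise_cons pairwise_rcons.
case/and3P=> /allP a'max /allP lmax /andP[/allP b'min _].
have a'E : a' = a.
  apply/le_anti; have /andP[_ ->] := bnd a' (mem_head _ _).
  by move: a_s; rewrite in_cons => /predU1P[-> /=|/a'max].
have b'l : b' <= l by apply: lmax; rewrite mem_rcons mem_head.
have b'a' : b' <= a' by apply: a'max; rewrite !(in_cons, mem_rcons) eqxx orbT.
have b'E : b' = b.
  apply/le_anti; have /andP[-> _] : b <= b' <= a.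
    by apply: bnd; rewrite !(in_cons, mem_rcons) eqxx !orbT.
  (* Wherever [b] occurs, the last entry [b'] is at most [b]. *)
  rewrite andbT; move: b_s; rewrite !(in_cons, mem_rcons).
  by case/or4P => [/eqP->|/eqP->|/eqP->|/b'min].
exists l, v; rewrite a'E b'E; split=> // x xv.
by apply: lmax; rewrite mem_rcons in_cons xv orbT.
Qed.

(** * The matrix D^-1 A of a graph without isolated vertices *)

Section Graph.
Variables (R : rcfType) (n : nat) (e : rel 'I_n).
Hypothesis deg_gt0 : forall i, (0 < degree e i)%N.

Let deg i : R := (degree e i)%:R.
Let M := normalized_adj_mx R e.

Let deg_neq0 i : deg i != 0.
Proof. by rewrite pnatr_eq0 -lt0n. Qed.

Lemma sum_adj i : \sum_j (e i j)%:R = deg i.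
Proof.
rewrite -natr_sum /deg /degree -sum1dep_card [in RHS]big_mkcond.
by congr (_%:R); apply: eq_bigr => j _; case: (e i j).
Qed.

Lemma normalized_adjE i j : M i j = (e i j)%:R / deg i.
Proof.
have Du : degree_mx R e \in unitmx.
  rewrite unitmxE det_diag unitfE; apply/prodf_neq0 => k _.
  by rewrite mxE; exact: deg_neq0.
have /matrixP/(_ i j) : degree_mx R e *m M = adj_mx R e by rewrite mulKVmx.
rewrite mul_diag_mx !mxE => <-.
by rewrite mulrAC divff ?mul1r //; exact: deg_neq0.
Qed.

(** [M] is row-stochastic, so acting on row vectors it does not increase the sum of absolute
    values. *)
Lemma eigenvalue_bound x : eigenvalue M x -> `|x| <= 1.
Proof.
case/eigenvalueP => v vM v_neq0.
have v1_gt0 : 0 < \sum_i `|v 0 i|.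
  have [i vi] : exists i, v 0 i != 0.
    apply/existsP; apply: contraNT v_neq0; rewrite negb_exists => /forallP v0.
    by apply/eqP/rowP => i; rewrite mxE; apply/eqP; rewrite -[_ == _]negbK v0.
  by rewrite (bigD1 i) //= ltr_pwDl ?normr_gt0 // sumr_ge0.
rewrite -(ler_pM2r v1_gt0) mul1r mulr_sumr.
have -> : \sum_i `|v 0 i| = \sum_j \sum_i `|v 0 i| * ((e i j)%:R / deg i).
  rewrite exchange_big; apply: eq_bigr => i _ /=.
  by rewrite -mulr_sumr -mulr_suml sum_adj divff ?mulr1 //.
apply: ler_sum => j _; rewrite -normrM.
have /rowP/(_ j) := vM; rewrite !mxE => <-.
apply: le_trans (ler_norm_sum _ _ _) _; apply: ler_sum => i _.
by rewrite normrM normalized_adjE [X in _ * X <= _]ger0_norm // divr_ge0 ?ler0n.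
Qed.

Hypothesis e_sym : symmetric e.

(* For the left action used by [eigenvalue], the eigenvector is the row c D. *)
Lemma eigenvalue_adj (c : 'I_n -> R) (z : R) : (0 < n)%N ->
  (forall i, c i != 0) -> (forall i j, e i j -> c i = z * c j) ->
  eigenvalue M z.
Proof.
move=> n_gt0 c_neq0 cE; apply/eigenvalueP; exists (\row_i (c i * deg i)).
  apply/rowP => j; rewrite !mxE -sum_adj mulrA mulr_sumr; apply: eq_bigr => i _.
  rewrite normalized_adjE !mxE mulrA mulrAC mulfK // [e j i]e_sym.
  by case: (boolP (e i j)) => [/cE-> //|_]; rewrite !mulr0.
apply/eqP => /rowP/(_ (Ordinal n_gt0)); rewrite !mxE => /eqP.
by apply/negP; rewrite mulf_neq0.
Qed.

Lemma tr_normalized_adj : irreflexive e -> \tr M = 0.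
Proof.
by move=> e_irr; apply: big1 => i _; rewrite normalized_adjE e_irr mul0r.
Qed.

(** The trace sums 1 / (d_i d_j) over ordered adjacent pairs, so it meets every edge twice. *)
Lemma tr_normalized_adj_sq : irreflexive e -> \tr (M *m M) = 2 * randic_m1 R e.
Proof.
move=> e_irr; pose w i j := (e i j)%:R / (deg i * deg j).
have wC i j : w i j = w j i by rewrite /w e_sym [deg i * _]mulrC.
have -> : randic_m1 R e = \sum_(i < n) \sum_(j < n | (i < j)%N) w i j.
  apply: eq_bigr => i _; rewrite big_mkcondr; apply: eq_bigr => j _.
  by rewrite /w; case: (e i j) => //; rewrite mul0r.
have -> : \tr (M *m M) = \sum_i \sum_j w i j.
  apply: eq_bigr => i _; rewrite mxE; apply: eq_bigr => j _.
  rewrite !normalized_adjE [e j i]e_sym /w invfM.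
  by case: (e i j); rewrite ?mul0r // !mul1r.
have -> : \sum_i \sum_j w i j
    = \sum_(i < n) \sum_(j < n | (i < j)%N) w i j
      + \sum_(i < n) \sum_(j < n | (j < i)%N) w i j.
  rewrite -big_split; apply: eq_bigr => i _ /=.
  rewrite (bigID (fun j : 'I_n => (i < j)%N)) /=; congr (_ + _).
  rewrite big_mkcond [RHS]big_mkcond; apply: eq_bigr => j _.
  rewrite -leqNgt leq_eqVlt; case: eqP => [/val_inj->|//] /=.
  by rewrite /w e_irr mul0r ltnn.
rewrite [X in _ + X](exchange_big_dep predT) //= mulr2n mulrDl mul1r.
by congr (_ + _); apply: eq_bigr => i _; apply: eq_bigr => j _; rewrite wC.
Qed.

Lemma normalized_adj_spectrum : exists s : seq R,
  [/\ char_poly M = \prod_(x <- s) ('X - x%:P), \tr M = \sum_(x <- s) x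
    & \tr (M *m M) = \sum_(x <- s) x ^+ 2].
Proof.
(* [S] is D^1/2 and [N] is D^-1/2 A D^-1/2, whence [S *m M = N *m S]. *)
pose S : 'M[R]_n := diag_mx (\row_i Num.sqrt (deg i)).
pose N : 'M[R]_n :=
  \matrix_(i, j) ((e i j)%:R / (Num.sqrt (deg i) * Num.sqrt (deg j))).
have sqrt_neq0 i : Num.sqrt (deg i) != 0.
  by rewrite sqrtr_eq0 -ltNge ltr0n.
have Su : S \in unitmx.
  rewrite unitmxE det_diag unitfE; apply/prodf_neq0 => k _.
  by rewrite mxE.
have SM : S *m M = N *m S.
  apply/matrixP => i j; rewrite mul_diag_mx mul_mx_diag [LHS]mxE [RHS]mxE normalized_adjE !mxE.
  rewrite invfM [in RHS]mulrA mulfVK // mulrCA; congr (_ * _).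
  by rewrite -[X in _ / X](sqr_sqrtr (ler0n _ _)) expr2 invfM mulrA divff ?mul1r.
have [] := @symmetric_diagonalization R n N.
  by apply/matrixP => i j; rewrite !mxE e_sym [_ * Num.sqrt _]mulrC.
move=> P [d [Pu NP]].
pose f := real_complex R.
have Sfu : map_mx f S \in unitmx by rewrite map_unitmx.
have PSu : P *m map_mx f S \in unitmx by rewrite unitmx_mul Pu.
have MP : map_mx f M
    = invmx (P *m map_mx f S) *m diag_mx (map_mx f d) *m (P *m map_mx f S).
  (* Multiplying on the left by the invertible [P *m map_mx f S] removes its inverse from the
     right-hand side. *)
  apply: (can_inj (mulKmx PSu)); rewrite -[X in _ = _ *m X]mulmxA mulKVmx //.
  by rewrite -mulmxA -map_mxM SM map_mxM NP !mulmxA mulmxV // mul1mx.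
have [charM trM trM2] := diagonalized_spectrum PSu MP.
exists [seq d 0 i | i <- index_enum 'I_n].
by rewrite !big_map.
Qed.

End Graph.

(** A path from [i] to some other vertex starts with an edge at [i]. *)
Lemma connected_degree_gt0 n (e : rel 'I_n) : (1 < n)%N ->
  connected_graph e -> forall i, (0 < degree e i)%N.
Proof.
move=> n_gt1 e_conn i.
have [j ji] : exists j : 'I_n, j != i.
  case: n n_gt1 e i {e_conn} => [|[|n]] // _ _ i.
  by exists (lift i ord0); rewrite eq_sym neq_lift.
case/connectP: (e_conn i j) => [[|k p]] /=; first by move=> _ jE; rewrite jE eqxx in ji.
by case/andP=> eik _ _; apply/card_gt0P; exists k; rewrite inE.
Qed.

Theorem theorem4p3 (R : rcfType) (n : nat) (e : rel 'I_n)
    (hn : (4 <= n)%N) (hsimple : simple_graph e)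
    (hconn : connected_graph e) (hbip : bipartite_graph e) :
  let lambda2 := second_eigenvalue (normalized_adj_mx R e) in
  Num.sqrt (2 * (randic_m1 R e - 1) / ((n%:R - 2) * (n%:R - 3))) <= lambda2
  /\ lambda2 <= Num.sqrt (2 * (n%:R - 3) * (randic_m1 R e - 1) / (n%:R - 2)).
Proof.
have [e_sym e_irr] := hsimple; have [X bipX] := hbip.
have deg_gt0 := connected_degree_gt0 (ltnW (ltnW hn)) hconn.
have n_gt0 : (0 < n)%N by exact: ltn_trans hn.
move=> lambda2; set M := normalized_adj_mx R e in lambda2 *.
have [s [charM trM trM2]] := normalized_adj_spectrum R deg_gt0 e_sym.
have permE := perm_eigenvalues charM.
have memE x : (x \in eigenvalues M) = eigenvalue M x.
  by rewrite (perm_mem permE) eigenvalue_root_char charM root_prod_XsubC.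
have size_E : size (eigenvalues M) = n.
  have := size_char_poly M.
  by rewrite charM size_prod_XsubC (perm_size permE) => -[].
have [l [v [EE vl]]] : exists l v,
    eigenvalues M = 1 :: l :: rcons v (-1) /\ {in v, forall x, x <= l}.
  apply: sorted_ends.
  - by rewrite size_E; exact: ltnW.
  - by apply: sort_sorted => x y; exact: le_total.
  (* The constant function gives the eigenvalue 1. *)
  - rewrite memE; apply: (@eigenvalue_adj _ _ _ deg_gt0 e_sym (fun=> 1)) => //.
      by move=> _; exact: oner_neq0.
    by move=> *; rewrite mulr1.
  (* The function equal to -1 on [X] and 1 off [X] changes sign along every edge, which gives the
     eigenvalue -1. *)
  - rewrite memE.
    apply: (@eigenvalue_adj _ _ _ deg_gt0 e_sym (fun i => (-1) ^+ (i \in X))) => //.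
      by move=> i; rewrite signr_eq0.
    move=> i j /bipX; case: (i \in X); case: (j \in X) => //= _;
      by rewrite ?expr0 ?expr1 ?mulr1 ?mulrNN ?mulr1.
  - by move=> x; rewrite memE => /(eigenvalue_bound deg_gt0); rewrite ler_norml.
have sumE (g : R -> R) : \sum_(x <- s) g x
    = g 1 + g (-1) + \sum_(x <- l :: v) g x.
  rewrite -(perm_big _ permE) EE -rcons_cons big_cons -cats1 big_cat big_seq1 /=.
  by ring.
have sum0 : \sum_(x <- l :: v) x = 0.
  by have := trM; rewrite tr_normalized_adj // (sumE id) /=; lra.
have sum2 : \sum_(x <- l :: v) x ^+ 2 = 2 * (randic_m1 R e - 1).
  by have := trM2; rewrite tr_normalized_adj_sq // (sumE (fun x => x ^+ 2)); lra.
have nE : n%:R = (size v)%:R + 3 :> R.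
  by rewrite -size_E EE /= size_rcons -addn3 natrD.
(* Here [size v] is n - 3, so n >= 4 makes both denominators positive. *)
have k_gt0 : 0 < (size v)%:R :> R.
  by have : 4 <= n%:R :> R; [rewrite ler_nat | rewrite nE; lra].
have [l_ge0 lower upper] := sum0_max_bounds sum0 vl.
rewrite sum2 in lower upper.
have -> : lambda2 = l by rewrite /lambda2 /second_eigenvalue EE.
have [-> ->] : n%:R - 2 = (size v)%:R + 1 :> R /\ n%:R - 3 = (size v)%:R :> R.
  by rewrite nE; split; ring.
move: (size v)%:R k_gt0 lower upper => k k_gt0 lower upper.
(* As [l] is nonnegative, it is the square root of [l ^+ 2], and it suffices to compare the
   radicands. *)
rewrite -[l]ger0_norm // -sqrtr_sqr; split; apply: ler_wsqrtr.
  by rewrite ler_pdivrMr ?mulr_gt0 //; lra.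
by rewrite ler_pdivlMr; lra.
Qed.
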